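(* Let $H$ be a connected, triangle-free, subcubic graph which is minimal with respect to Reductions 1–4, i.e. (R1) $H$ has no vertex of degree $1$; (R2) $H$ has no two adjacent vertices both of degree $2$; (R3) $H$ has no induced $4$-cycle $w_1w_2w_3w_4$ with $d(w_1)=d(w_3)=2$; (R4) $H$ has no cut-edge. Suppose $H$ contains no (not necessarily induced) subgraph isomorphic to $S_{3,3,3}$, and $H$ contains an induced $C_5$. Then $H$ is isomorphic to $D_7$, or $H$ is isomorphic to $P^*$, or $H$ is an overfull graph consisting of a cycle $C_9$ with $4$ chords, or $H$ is $3$-edge-colorable.
   Context: All graphs are finite, simple and undirected; $d(v)$ is the degree of $v$ in $H$; subcubic means maximum degree at most $3$. $S_{a,b,c}$ is the tree consisting of three paths of lengths $a,b,c$ sharing exactly one common endvertex. $D_7$ is $K_{3,3}$ with one edge subdivided once. $P^*$ is the Petersen graph with one vertex deleted. $H$ is overfull if $|E(H)|>\alpha'(H)\Delta(H)$, with $\alpha'$ the matching number and $\Delta$ the maximum degree. ''A cycle $C_9$ with $4$ chords'' means a graph on $9$ vertices having a Hamiltonian cycle and exactly $4$ further edges. $3$-edge-colorable means having a proper edge coloring with at most $3$ colors. *)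

(* Defs.v *)
From mathcomp Require Import all_boot.

Set Implicit Arguments.
Unset Strict Implicit.
Unset Printing Implicit Defensive.

Record sgraph := SGraph {
  vertex :> finType;
  edge_rel : rel vertex;
  edge_sym : symmetric edge_rel;
  edge_irrefl : irreflexive edge_rel }.

Notation "x -- y" := (edge_rel x y) (at level 30, no associativity).

Section Invariants.
Variable G : sgraph.
Implicit Types (x y u v : G) (M : {set {set G}}).

Definition edges : {set {set G}} :=
  [set A | [exists x, exists y, (x -- y) && (A == [set x; y])]].

Definition deg x : nat := #|[set y | x -- y]|.

Definition max_deg : nat := \max_(x : G) deg x.

Definition subcubic : Prop := max_deg <= 3.

Definition triangle_free : Prop :=
  forall x y z, ~ [/\ x -- y, y -- z & z -- x].

Definition connected : Prop := forall x y, connect (@edge_rel G) x y.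

Definition num_components : nat := n_comp (@edge_rel G) G.

(* On {set {set G}}, trivIset says that distinct members are disjoint. *)
Definition matching M : bool := (M \subset edges) && trivIset M.

Definition matching_number : nat := \max_(M | matching M) #|M|.

Definition overfull : Prop := matching_number * max_deg < #|edges|.

Definition edge_colorable (k : nat) : Prop :=
  exists c : {set G} -> 'I_k, forall A B, A \in edges -> B \in edges ->
    A != B -> A :&: B != set0 -> c A != c B.

Definition induced_C4 (w1 w2 w3 w4 : G) : Prop :=
  [/\ uniq [:: w1; w2; w3; w4],
      [/\ w1 -- w2, w2 -- w3, w3 -- w4 & w4 -- w1],
      ~~ (w1 -- w3) & ~~ (w2 -- w4)].

End Invariants.

Section Constructions.
Variable G : sgraph.

Section DeleteEdge.
Variables u v : G.
Definition del_edge_rel : rel G :=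
  fun x y => (x -- y) && ([set x; y] != [set u; v]).
Lemma del_edge_sym : symmetric del_edge_rel.
Proof. by move=> x y; rewrite /del_edge_rel edge_sym setUC. Qed.
Lemma del_edge_irrefl : irreflexive del_edge_rel.
Proof. by move=> x; rewrite /del_edge_rel edge_irrefl. Qed.
Definition del_edge : sgraph := SGraph del_edge_sym del_edge_irrefl.
End DeleteEdge.

Definition cut_edge (u v : G) : Prop :=
  u -- v /\ num_components G < num_components (del_edge u v).

Section DeleteVertex.
Variable v : G.
Definition del_vertex_rel : rel {x : G | x != v} :=
  fun x y => val x -- val y.
Lemma del_vertex_sym : symmetric del_vertex_rel.
Proof. by move=> x y; apply: edge_sym. Qed.
Lemma del_vertex_irrefl : irreflexive del_vertex_rel.
Proof. by move=> x; apply: edge_irrefl. Qed.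
Definition del_vertex : sgraph := SGraph del_vertex_sym del_vertex_irrefl.
End DeleteVertex.

(* The edge uv is subdivided by the new vertex None. *)
Section SubdivideEdge.
Variables u v : G.
Definition subdivide_rel : rel (option G) := fun a b =>
  match a, b with
  | Some x, Some y => (x -- y) && ([set x; y] != [set u; v])
  | Some x, None | None, Some x => x \in [set u; v]
  | None, None => false
  end.
Lemma subdivide_sym : symmetric subdivide_rel.
Proof. by move=> [x|] [y|] //=; rewrite edge_sym setUC. Qed.
Lemma subdivide_irrefl : irreflexive subdivide_rel.
Proof. by move=> [x|] //=; rewrite edge_irrefl. Qed.
Definition subdivide : sgraph := SGraph subdivide_sym subdivide_irrefl.
End SubdivideEdge.

End Constructions.

Definition sub_embedding (F G : sgraph) (f : F -> G) : Prop :=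
  injective f /\ forall x y, x -- y -> f x -- f y.

Definition ind_embedding (F G : sgraph) (f : F -> G) : Prop :=
  injective f /\ forall x y, (f x -- f y) = (x -- y).

Definition has_subgraph (F G : sgraph) : Prop :=
  exists f : F -> G, sub_embedding f.

Definition has_induced_subgraph (F G : sgraph) : Prop :=
  exists f : F -> G, ind_embedding f.

Definition isomorphic (F G : sgraph) : Prop :=
  exists f : F -> G, bijective f /\ forall x y, (f x -- f y) = (x -- y).

(* The cycle C_n for n >= 3. *)
Section CycleGraph.
Variable n : nat.
Definition cycle_rel : rel 'I_n :=
  fun i j => (i != j) && ((j == ordS i) || (i == ordS j)).
Lemma cycle_sym : symmetric cycle_rel.
Proof. by move=> i j; rewrite /cycle_rel eq_sym orbC. Qed.
Lemma cycle_irrefl : irreflexive cycle_rel.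
Proof. by move=> i; rewrite /cycle_rel eqxx. Qed.
Definition cycle_graph : sgraph := SGraph cycle_sym cycle_irrefl.
End CycleGraph.

(* The tree S_{a,b,c}: None is the common endvertex, and each leg is numbered
   from the vertex next to None outwards. *)
Section Spider.
Variables a b c : nat.
Definition consec (i j : nat) : bool := (j == i.+1) || (i == j.+1).
Definition spider_rel : rel (option ('I_a + 'I_b + 'I_c)) := fun s t =>
  match s, t with
  | Some (inl (inl i)), Some (inl (inl j)) => consec i j
  | Some (inl (inr i)), Some (inl (inr j)) => consec i j
  | Some (inr i), Some (inr j) => consec i j
  | None, Some (inl (inl i)) | Some (inl (inl i)), None => i == 0 :> nat
  | None, Some (inl (inr i)) | Some (inl (inr i)), None => i == 0 :> nat
  | None, Some (inr i) | Some (inr i), None => i == 0 :> nat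
  | _, _ => false
  end.
Lemma spider_sym : symmetric spider_rel.
Proof. by move=> [[[i|i]|i]|] [[[j|j]|j]|] //=; rewrite /consec orbC. Qed.
Lemma spider_irrefl : irreflexive spider_rel.
Proof.
by move=> [[[i|i]|i]|] //=; rewrite /consec orbb -[LHS]/(_ == _) ltn_eqF.
Qed.
Definition spider : sgraph := SGraph spider_sym spider_irrefl.
End Spider.

Section CompleteBipartite.
Variables m n : nat.
Definition biclique_rel : rel ('I_m + 'I_n) := fun x y =>
  match x, y with inl _, inr _ | inr _, inl _ => true | _, _ => false end.
Lemma biclique_sym : symmetric biclique_rel.
Proof. by move=> [i|i] [j|j]. Qed.
Lemma biclique_irrefl : irreflexive biclique_rel.
Proof. by move=> [i|i]. Qed.
Definition biclique : sgraph := SGraph biclique_sym biclique_irrefl.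
End CompleteBipartite.

(* K_{3,3} is edge-transitive, so any edge may be subdivided. *)
Definition D7 : sgraph :=
  @subdivide (biclique 3 3) (inl ord0) (inr ord0).

(* The usual drawing of the Petersen graph: (false, i) are the vertices of the
   outer 5-cycle, (true, i) those of the inner pentagram. *)
Definition petersen_rel : rel (bool * 'I_5) := fun x y =>
  match x, y with
  | (false, i), (false, j) => (j == ordS i) || (i == ordS j)
  | (true, i), (true, j) => (j == ordS (ordS i)) || (i == ordS (ordS j))
  | (_, i), (_, j) => i == j
  end.
Lemma petersen_sym : symmetric petersen_rel.
Proof. by move=> [[] i] [[] j] /=; rewrite 1?orbC // eq_sym. Qed.
Lemma petersen_irrefl : irreflexive petersen_rel.
Proof. by move=> [[] [[|[|[|[|[|i]]]]] lti]]. Qed.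
Definition petersen : sgraph := SGraph petersen_sym petersen_irrefl.

(* The Petersen graph is vertex-transitive, so any vertex may be deleted. *)
Definition petersen_minus_vertex : sgraph :=
  @del_vertex petersen (false, ord0).

(* The edges of G outside the image of the edge set of a Hamiltonian cycle are
   its chords. *)
Definition cycle_with_chords (n k : nat) (G : sgraph) : Prop :=
  #|G| = n /\
  exists f : cycle_graph n -> G, sub_embedding f /\
    #|edges G :\: [set f @: A | A : {set cycle_graph n} in edges (cycle_graph n)]| = k.

(* Main.v *)
Require Import Defs.
From mathcomp Require Import all_boot.

(* A graph satisfying the hypotheses is reconstructed from its 5-cycle.  A partial
   reconstruction consists of vertices 0, ..., n - 1, known edges E between them,
   and a set T of vertices known to have degree 2.  Take the first vertex v some
   of whose edges may still be unknown: either it has degree 2 and no further edge,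
   or another edge leads to a known vertex, or to a new one.  A branch is dropped
   when it violates a reduction, acquires a cut-edge or contains S_{3,3,3}.  The
   resulting search tree is finite, with about 11000 nodes, and every surviving
   leaf has at most 9 vertices: it is 3-edge-colourable, or D_7, or P^*, or a
   Hamiltonian graph with 9 vertices and 13 edges, which is overfull because a
   matching has at most 4 edges. *)

Set Implicit Arguments.
Unset Strict Implicit.
Unset Printing Implicit Defensive.

(** * Search procedures on graphs given by edge lists *)

Implicit Types (i j u v w n k : nat) (e : nat * nat) (E : seq (nat * nat)).
Implicit Types (N : nat -> seq nat) (T W : seq nat).
Implicit Types K : seq ((nat * nat) * nat).

(* [has] with the disjunction replaced by a conditional, as [vm_compute]
   evaluates both arguments of [||]. *)
Fixpoint some (A : Type) (a : A -> bool) (s : seq A) :=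
  if s is x :: s' then if a x then true else some a s' else false.

Lemma someE (A : Type) (a : A -> bool) s : some a s = has a s.
Proof. by elim: s => //= x s ->; case: (a x). Qed.

Definition adj E i j := ((i, j) \in E) || ((j, i) \in E).

Definition nbrs E i :=
  undup ([seq e.2 | e <- E & e.1 == i] ++ [seq e.1 | e <- E & e.2 == i]).

(** Computed once per node of the search tree, so that evaluation does not rescan [E] at every
    lookup. *)
Definition table n E := mkseq (nbrs E) n.

(** In a subcubic graph this means that every edge at [i] is known: a vertex of [T] has degree 2,
    any other at most 3. *)
Definition full N T i := size (N i) == 3 - (i \in T).

Definition copy n N E W :=
  [&& uniq W, all (gtn n) W &
      all (fun e => nth 0 W e.2 \in N (nth 0 W e.1)) E].

(** Every pattern lists its edges with the smaller end first, so the entry for [k] consists of its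
    neighbours numbered before [k]. *)
Definition back m E := mkseq (fun k => [seq e.1 | e <- E & e.2 == k]) m.

(* W lists the images of the first vertices of the pattern; the entries of P, one
   for each later vertex, list its neighbours among the preceding vertices. *)
Fixpoint search n N E P W :=
  if P is b :: P' then
    let cands := if b is p :: _ then N (nth 0 W p) else iota 0 n in
    some (fun j => if j \in W then false else
                   if all (fun i => j \in N (nth 0 W i)) (behead b)
                   then search n N E P' (rcons W j) else false) cands
  else copy n N E W.

Definition meet (d e : nat * nat) :=
  [|| d.1 == e.1, d.1 == e.2, d.2 == e.1 | d.2 == e.2].

(** Backtracking; [K] holds the edges coloured so far with their colours. *)
Fixpoint colorable E K :=
  if E is e :: E' then
    some (fun k => if all (fun p => meet p.1 e ==> (p.2 != k)) K
                   then colorable E' ((e, k) :: K) else false) (iota 0 3)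
  else true.

(* Only a heuristic: its result is tested by cut_side. *)
Fixpoint side N T u v fuel todo acc :=
  if fuel is k.+1 then
    if todo is x :: todo' then
      if x \in acc then side N T u v k todo' acc else
      if ~~ full N T x || (x == v) then [::] else
      side N T u v k
        ([seq y <- N x | (x != u) || (y != v)] ++ todo') (x :: acc)
    else acc
  else [::].

(** A certificate that [uv] is a cut-edge: all edges at vertices of [A] are known, and only [uv]
    leaves [A]. *)
Definition cut_side N T u v (A : seq nat) :=
  [&& u \in A, v \notin A, all (full N T) A &
      all (fun a => all (fun b => (b \in A) || (a == u) && (b == v)) (N a)) A].

Definition C5_edges := [:: (0, 1); (1, 2); (2, 3); (3, 4); (0, 4)].
Definition C9_edges :=
  [:: (0, 1); (1, 2); (2, 3); (3, 4); (4, 5); (5, 6); (6, 7); (7, 8); (0, 8)].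
(* The centre 0 and its neighbours 1, 2, 3 come first, so that they can be
   prescribed in has_spider. *)
Definition spider_edges :=
  [:: (0, 1); (0, 2); (0, 3); (1, 4); (4, 5); (2, 6); (6, 7); (3, 8); (8, 9)].
(** The parts of $K_{3,3}$ are 0, 1, 2 and 3, 4, 5; the vertex 6 subdivides the edge 03. *)
Definition D7_edges :=
  [:: (0, 4); (0, 5); (1, 3); (1, 4); (1, 5); (2, 3); (2, 4); (2, 5);
      (0, 6); (3, 6)].
(* The deleted vertex is the outer vertex 0; the outer vertex i is numbered i - 1,
   the inner vertex i is numbered 4 + i. *)
Definition Petersen_edges :=
  [:: (0, 1); (1, 2); (2, 3); (0, 5); (1, 6); (2, 7); (3, 8);
      (4, 6); (5, 7); (6, 8); (4, 7); (5, 8)].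

(** The three legs have equal length, so one order of the neighbours of the centre suffices. *)
Definition has_spider n N :=
  some (fun c => if size (N c) == 3 then
                   search n N spider_edges
                     (drop 4 (back 10 spider_edges)) (c :: N c)
                 else false) (iota 0 n).

(** The tests concern, in order, R2, R3, $S_{3,3,3}$ and R4. For R3 two common neighbours are
    enough, as triangle-freeness makes the 4-cycle induced. The number 100 only limits the heuristic
    [side]. *)
Definition refuted n N E T :=
  if has (fun e => (e.1 \in T) && (e.2 \in T)) E then true else
  if has (fun i => has (fun j => (i != j) &&
       (1 < size [seq x <- N i | x \in N j])) T) T then true else
  if has_spider n N then true else
  some (fun u => some (fun v =>
       cut_side N T u v (side N T u v 100 [:: u] [::])) (N u)) (iota 0 n).

Definition spanned n N E m E' :=
  if (n == m) && (size E == size E') then search n N E' (back m E') [::]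
  else false.

(** The test on [E] ensures that [size E] counts each edge once. The exploration respects it, since
    a new edge runs from the first vertex that is not full to a later one. *)
Definition outcome n N E :=
  if colorable E [::] then true else
  if ~~ (uniq E && all (fun e => e.1 < e.2) E) then false else
  if spanned n N E 7 D7_edges then true else
  if spanned n N E 9 Petersen_edges then true else
  if (n == 9) && (size E == 13) then search n N C9_edges (back 9 C9_edges) [::]
  else false.

(** The three conjuncts are the cases at [v]: no further edge, where R1 excludes degree 1; an edge
    to a known [u], unless it would close a triangle; an edge to the new vertex [n]. *)
Fixpoint explore fuel n E T :=
  if fuel is k.+1 then
    let tb := table n E in
    let N := nth [::] tb in
    if refuted n N E T then true else
    if [seq i <- iota 0 n | ~~ full N T i] is v :: _ then
      [&& if size (N v) == 1 then true else
           if size (N v) == 2 then explore k n E (v :: T) else false,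
          all (fun u => if [|| u == v, full N T u, u \in N v
                            | has (fun w => w \in N u) (N v)] then true
                        else explore k n ((v, u) :: E) T) (iota 0 n)
        & explore k n.+1 ((v, n) :: E) T]
    else outcome n N E
  else false.

(** * Partial reconstructions realized in a graph *)

Lemma mem_table n E i j :
  (j \in nth [::] (table n E) i) = (i < n) && adj E i j.
Proof.
have [ltin|leni] := ltnP i n; last by rewrite nth_default // size_mkseq.
rewrite nth_mkseq // mem_undup mem_cat /adj; congr (_ || _); apply/mapP/idP.
- by case=> -[a b]; rewrite mem_filter /= => /andP[/eqP-> ?] ->.
- by move=> Eij; exists (i, j); rewrite // mem_filter eqxx.
- by case=> -[a b]; rewrite mem_filter /= => /andP[/eqP-> ?] ->.
by move=> Eji; exists (j, i); rewrite // mem_filter eqxx.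
Qed.

Lemma uniq_table n E i : uniq (nth [::] (table n E) i).
Proof.
have [ltin|leni] := ltnP i n; last by rewrite nth_default // size_mkseq.
by rewrite nth_mkseq // undup_uniq.
Qed.

Section Graph.
Variable G : sgraph.
Implicit Types (x y : G) (f : nat -> G).

Lemma max_deg_ge x : deg x <= max_deg G.
Proof. exact: (leq_bigmax x). Qed.

(** Once [xy] is deleted, [A] is closed under adjacency and separates [x] from [y], so the single
    component of [G] splits. *)
Lemma cut_edge_closed x y (A : {pred G}) : connected G -> x -- y ->
  x \in A -> y \notin A ->
  (forall a b, a \in A -> a -- b -> b \in A \/ a = x /\ b = y) ->
  cut_edge x y.
Proof.
move=> conn xy Ax A'y closedA; split=> //; rewrite /num_components.
have symG : connect_sym (@edge_rel G) by apply/sym_connect_sym/edge_sym.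
have symD : connect_sym (del_edge_rel x y) by apply/sym_connect_sym/del_edge_sym.
have -> : n_comp (@edge_rel G) G = 1.
  rewrite -(n_comp_connect symG x); apply: eq_n_comp_r => z.
  by rewrite !inE conn.
have A_closed : closed (del_edge_rel x y) (mem A).
  apply: (intro_closed symD) => a b /andP[ab nab] Aa.
  have [//|[ea eb]] := closedA a b Aa ab.
  by rewrite ea eb eqxx in nab.
have nxy : root (del_edge_rel x y) x != root (del_edge_rel x y) y.
  rewrite (root_connect symD); apply/negP => /(closed_connect A_closed) /=.
  by rewrite Ax (negPf A'y).
rewrite /n_comp_mem; apply/card_gt1P.
exists (root (del_edge_rel x y) x), (root (del_edge_rel x y) y).
by split=> //; rewrite !inE /= roots_root ?symD.
Qed.

(** The knowledge is partial: pairs absent from [E] may still be adjacent in [G]. *)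
Record realizes n E T f : Prop := Realizes {
  realizes_inj : forall i j, i < n -> j < n -> f i = f j -> i = j;
  realizes_edge : forall i j, (i, j) \in E -> [/\ i < n, j < n & f i -- f j];
  realizes_deg : forall i, i \in T -> i < n /\ deg (f i) = 2 }.

Section Realization.
Variables (n : nat) (E : seq (nat * nat)) (T : seq nat) (f : nat -> G).
Hypothesis fE : realizes n E T f.
Let N := nth [::] (table n E).

Lemma realizes_nbr i j : j \in N i -> [/\ i < n, j < n & f i -- f j].
Proof.
rewrite mem_table => /andP[_ /orP[] /(realizes_edge fE)[]] //.
by rewrite edge_sym.
Qed.

Lemma table_sym i j : (j \in N i) = (i \in N j).
Proof.
by apply/idP/idP=> /[dup] /realizes_nbr[? ? _];
  rewrite !mem_table /adj orbC => /andP[_ ->]; apply/andP.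
Qed.

Lemma realizes_nbrs_sub i :
  [set:: map f (N i)] \subset [set y | f i -- y].
Proof.
by apply/subsetP => y; rewrite !inE => /mapP[j /realizes_nbr[_ _ ?] ->].
Qed.

Lemma card_realizes_nbrs i : #|[set:: map f (N i)]| = size (N i).
Proof.
rewrite cardsE -(size_map f); apply/card_uniqP.
rewrite map_inj_in_uniq ?uniq_table //.
move=> j k /realizes_nbr[_ ? _] /realizes_nbr[_ ? _].
exact: realizes_inj fE _ _ _ _.
Qed.

(** [f] maps [N i] injectively into the neighbourhood of [f i], so the degree bound forces
    equality. *)
Lemma size_nbrs_full i : deg (f i) <= size (N i) ->
  forall y, f i -- y -> exists2 j, j \in N i & y = f j.
Proof.
move=> led y iy.
have : y \in [set:: map f (N i)].
  suff /eqP-> : [set:: map f (N i)] == [set z | f i -- z] by rewrite inE.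
  by rewrite eqEcard realizes_nbrs_sub card_realizes_nbrs.
by rewrite inE => /mapP[j ? ?]; exists j.
Qed.

Hypothesis subcubicG : subcubic G.

Lemma full_nbr i y : full N T i -> f i -- y -> exists2 j, j \in N i & y = f j.
Proof.
move=> /eqP sN; apply: size_nbrs_full; rewrite sN.
case: (boolP (i \in T)) => [/(realizes_deg fE)[_ ->] // | _].
exact: leq_trans (max_deg_ge _) subcubicG.
Qed.

Lemma cut_sideP A i j : connected G -> j \in N i -> cut_side N T i j A ->
  cut_edge (f i) (f j).
Proof.
move=> conn ij /and4P[Ai A'j /allP Afull /allP Aside].
have [ltin ltjn fij] := realizes_nbr ij.
(* A full vertex has at least two known neighbours, whereas an index from [n] on has none. *)
have Altn a : a \in A -> a < n.
  move=> /Afull/eqP; case Na: (N a) => [|b s]; last first.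
    by have [] := @realizes_nbr a b; rewrite // Na mem_head.
  by case: (a \in T).
apply: (@cut_edge_closed _ _ [pred x in map f A]) => //.
- exact: map_f.
- apply: contra A'j => /mapP[a Aa /realizes_inj].
  by move=> /(_ _ _ _ fE ltjn (Altn a Aa)) ->.
move=> _ b /mapP[a Aa ->] ab.
have [k ak ->] := full_nbr (Afull a Aa) ab.
have /allP/(_ k ak) /orP[Ak|/andP[/eqP-> /eqP->]] := Aside a Aa; last by right.
by left; apply: map_f.
Qed.

End Realization.
End Graph.

(** Soundness rests on the final test [copy] alone; the earlier filters merely prune. *)
Lemma search_copy n N E P W : search n N E P W ->
  exists2 W', copy n N E W' & size W' = size W + size P.
Proof.
elim: P W => [|b P IH] W /= => [cW|]; first by exists W; rewrite ?addn0.
rewrite someE => /hasP[j _]; case: ifP => // _; case: ifP => // _ /IH[W' cW' sW'].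
by exists W'; rewrite // sW' size_rcons addSnnS.
Qed.

(** * Edges, embeddings and overfullness *)

Lemma mem_edges (F : sgraph) (x y : F) : ([set x; y] \in edges F) = (x -- y).
Proof.
rewrite inE; apply/existsP/idP => [[a /existsP[b /andP[ab /eqP eqab]]]|xy];
  last first.
  by exists x; apply/existsP; exists y; rewrite xy eqxx.
have: a \in [set x; y] by rewrite eqab set21.
have: b \in [set x; y] by rewrite eqab set22.
rewrite !inE => /orP[]/eqP eb /orP[]/eqP ea; move: ab; rewrite ea eb ?edge_irrefl //.
by rewrite edge_sym.
Qed.

Lemma edgesP (F : sgraph) (A : {set F}) :
  reflect (exists x y, x -- y /\ A = [set x; y]) (A \in edges F).
Proof.
rewrite inE.
apply: (iffP existsP) => [[x /existsP[y /andP[xy /eqP->]]]|[x [y [xy ->]]]].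
  by exists x, y.
by exists x; apply/existsP; exists y; rewrite xy eqxx.
Qed.

Section Edges.
Variables (F G : sgraph) (h : F -> G).
Hypothesis h_sub : sub_embedding h.

Lemma sub_embedding_edges : [set h @: A | A : {set F} in edges F] \subset edges G.
Proof.
apply/subsetP => _ /imsetP[_ /edgesP[x [y [xy ->]]] ->].
by rewrite imsetU1 imset_set1 mem_edges h_sub.2.
Qed.

Lemma card_sub_embedding_edges :
  #|[set h @: A | A : {set F} in edges F]| = #|edges F|.
Proof. by apply: card_imset; apply: imset_inj; apply: h_sub.1. Qed.

(** The injection on edges is onto by cardinality, so [h] reflects adjacency as well; its inverse is
    the isomorphism. *)
Lemma sub_embedding_isomorphic :
  #|F| = #|G| -> #|edges F| = #|edges G| -> isomorphic G F.
Proof.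
move=> cFG eFG.
have h_bij : bijective h by apply: inj_card_bij h_sub.1 _; rewrite cFG.
have [g hK gK] := h_bij; exists g; split=> [|x y]; first by exists h.
rewrite -{2}[x]gK -{2}[y]gK; apply/idP/idP => [|hh]; first exact: h_sub.2.
have : [set h (g x); h (g y)] \in [set h @: A | A : {set F} in edges F].
  suff /eqP-> : [set h @: A | A : {set F} in edges F] == edges G.
    by rewrite mem_edges.
  by rewrite eqEcard sub_embedding_edges card_sub_embedding_edges eFG /=.
have -> : [set h (g x); h (g y)] = h @: [set g x; g y] by rewrite imsetU1 imset_set1.
case/imsetP => A eA /(imset_inj h_sub.1) defA.
by rewrite -mem_edges defA.
Qed.

End Edges.

(** A matching on at most $2k+1$ vertices has at most $k$ edges. *)
Lemma overfull_odd (G : sgraph) k : subcubic G -> #|G| <= k.*2.+1 ->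
  k * 3 < #|edges G| -> overfull G.
Proof.
move=> cubG cG; apply: leq_ltn_trans; rewrite leq_mul //.
apply/bigmax_leqP => M /andP[/subsetP sM /eqP triv].
suff : #|M|.*2 <= k.*2.+1 by rewrite leq_Sdouble.
(* Count the covered vertices: two per edge of [M], and disjointness turns the sum into the size of
   the cover. *)
apply: leq_trans cG; rewrite -muln2 -sum_nat_const.
rewrite (eq_bigr (fun A : {set G} => #|A|)); last first.
  move=> A /sM/edgesP[x [y [xy ->]]]; rewrite cards2.
  by case: eqP xy => // ->; rewrite edge_irrefl.
by rewrite triv; apply: max_card.
Qed.

(** * Graphs described completely by an edge list *)

Record labelling (F : sgraph) n E (l : F -> nat) : Prop := Labelling {
  label_inj : injective l;
  label_lt : forall x, l x < n;
  label_card : #|F| = n;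
  label_edge : forall x y, (x -- y) = adj E (l x) (l y) }.

Section Labelling.
Variables (F : sgraph) (n : nat) (E : seq (nat * nat)) (l : F -> nat).
Hypothesis lE : labelling n E l.

Definition edge_set e : {set F} := [set x | (l x == e.1) || (l x == e.2)].

Lemma edge_set2 x y : edge_set (l x, l y) = [set x; y].
Proof. by apply/setP => z; rewrite !inE !(inj_eq (label_inj lE)). Qed.

Lemma edges_edge_set (A : {set F}) : A \in edges F ->
  exists2 e, e \in E & A = edge_set e.
Proof.
case/edgesP => x [y []]; rewrite (label_edge lE) => /orP[] exy ->.
  by exists (l x, l y); rewrite ?edge_set2.
by exists (l y, l x); rewrite ?edge_set2 // setUC.
Qed.

Lemma label_onto i : i < n -> exists x, l x = i.
Proof.
move=> ltin; pose l' x := Ordinal (label_lt lE x).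
have injl' : injective l' by move=> x y [/(label_inj lE)].
have /codomP[x /(congr1 val)/= ->] : Ordinal ltin \in codom l'.
  by apply: inj_card_onto; rewrite // card_ord (label_card lE).
by exists x.
Qed.

(** With the smaller label first, an edge determines its pair, so [edge_set] is injective on [E]. *)
Lemma card_edges : uniq E -> all (fun e => e.1 < e.2 < n) E -> #|edges F| = size E.
Proof.
move=> uE /allP ltE; rewrite -(size_map edge_set).
have onto e : e \in E -> exists x y, (l x, l y) = e.
  move=> /ltE/andP[lt12 lt2n].
  have [x lx] := label_onto (ltn_trans lt12 lt2n).
  have [y ly] := label_onto lt2n.
  by exists x, y; rewrite lx ly -surjective_pairing.
have -> : edges F = [set:: map edge_set E].
  apply/setP => A; rewrite [RHS]inE.
  apply/idP/mapP => [/edges_edge_set[e Ee ->]|[e Ee ->]].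
    by exists e.
  have [x [y exy]] := onto e Ee.
  by rewrite -exy edge_set2 mem_edges (label_edge lE) /adj exy Ee.
rewrite cardsE; apply/card_uniqP; rewrite map_inj_in_uniq // => d e Ed Ee.
have [x [y dxy]] := onto d Ed; have [z [t ezt]] := onto e Ee.
rewrite -dxy -ezt !edge_set2 => eqs.
have ltd : l x < l y by move/ltE: Ed; rewrite -dxy => /andP[].
have lte : l z < l t by move/ltE: Ee; rewrite -ezt => /andP[].
have: x \in [set z; t] by rewrite -eqs set21.
have: y \in [set z; t] by rewrite -eqs set22.
rewrite !inE => /orP[]/eqP ey /orP[]/eqP ex; move: ltd; rewrite ex ey ?ltnn //.
by rewrite ltnNge ltnW.
Qed.

End Labelling.

(** * Edge colourings *)

Lemma meetC d e : meet d e = meet e d.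
Proof.
rewrite /meet [d.1 == _]eq_sym [d.1 == e.2]eq_sym.
rewrite [d.2 == _]eq_sym [d.2 == e.2]eq_sym.
by case: (e.1 == d.1); case: (e.2 == d.1); case: (e.1 == d.2).
Qed.

(** Only distinct pairs are compared, so a pair might carry several colours;
    [labelling_edge_colorable] selects one of them by [find]. *)
Definition proper K := forall p q, p \in K -> q \in K ->
  p.1 != q.1 -> meet p.1 q.1 -> p.2 != q.2.

Lemma colorableP E K : colorable E K -> proper K ->
  exists K', [/\ proper K', {subset K <= K'}
               & forall e, e \in E -> exists2 k, k < 3 & (e, k) \in K'].
Proof.
elim: E K => [|e E IH] K; first by exists K; split.
rewrite -[colorable _ _]/(some _ (iota 0 3)) someE => /hasP[k].
rewrite mem_iota => /= ltk3.
case: ifP => // /allP okk /IH{}IH propK.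
have {}okk p : p \in K -> meet p.1 e -> p.2 != k by move=> /okk/implyP.
case: IH => [p q|K' [propK' subK' colE]].
  rewrite !inE => /predU1P[->|Kp] /predU1P[->|Kq] //=; first by rewrite eqxx.
  - by rewrite meetC eq_sym => _ /(okk q Kq); rewrite eq_sym.
  - by move=> _; apply: okk.
  exact: propK.
exists K'; split=> // [p Kp|d]; first by apply: subK'; rewrite inE Kp orbT.
rewrite inE => /predU1P[->|/colE//]; exists k => //.
by apply: subK'; rewrite mem_head.
Qed.

Lemma labelling_edge_colorable (F : sgraph) n E (l : F -> nat) :
  labelling n E l -> colorable E [::] -> edge_colorable F 3.
Proof.
move=> lE /colorableP[// | K [propK _ colE]].
(* [d0] is a mere default: [find] succeeds for every edge [A]. *)
pose d0 := ((0, 0), 0); pose color (A : {set F}) :=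
  nth d0 K (find (fun p => (p.2 < 3) && (A == edge_set l p.1)) K).
have colorP (A : {set F}) : A \in edges F ->
    [/\ color A \in K, (color A).2 < 3 & A = edge_set l (color A).1].
  case/(edges_edge_set lE) => e /colE[k ltk3 Kk] defA.
  have hasA : has (fun p => (p.2 < 3) && (A == edge_set l p.1)) K.
    by apply/hasP; exists (e, k); rewrite //= ltk3 defA eqxx.
  have /andP[? /eqP?] := nth_find d0 hasA.
  by split; rewrite // mem_nth -?has_find.
exists (fun A => inord (color A).2) => A B /colorP[KA ltA defA] /colorP[KB ltB defB].
move=> nAB /set0Pn[x]; rewrite inE => /andP[].
rewrite {1}defA {1}defB !inE => xA xB.
have: (color A).2 != (color B).2.
  apply: propK => //; first by apply: contraNneq nAB => eqAB; rewrite defA defB eqAB.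
  by rewrite /meet; case/orP: xA xB => /eqP<- /orP[]/eqP<-; rewrite eqxx ?orbT.
by apply: contraNneq => /(congr1 val)/=; rewrite !inordK // => ->.
Qed.

(** * Labellings of the named graphs, checked vertex by vertex *)

Definition spider_label (x : spider 3 3 3) : nat :=
  match x with
  | None => 0
  | Some (inl (inl i)) => nth 0 [:: 1; 4; 5] i
  | Some (inl (inr i)) => nth 0 [:: 2; 6; 7] i
  | Some (inr i) => nth 0 [:: 3; 8; 9] i
  end.

Lemma spider_labelling : labelling 10 spider_edges spider_label.
Proof.
split.
- move=> [[[[[|[|[|i]]] p]|[[|[|[|i]]] p]]|[[|[|[|i]]] p]]|]
    [[[[[|[|[|j]]] q]|[[|[|[|j]]] q]]|[[|[|[|j]]] q]]|] //= _;
  by rewrite (bool_irrelevance p q).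
- by move=> [[[[[|[|[|i]]] ?]|[[|[|[|i]]] ?]]|[[|[|[|i]]] ?]]|].
- by rewrite card_option !card_sum !card_ord.
by move=> [[[[[|[|[|i]]] ?]|[[|[|[|i]]] ?]]|[[|[|[|i]]] ?]]|]
  [[[[[|[|[|j]]] ?]|[[|[|[|j]]] ?]]|[[|[|[|j]]] ?]]|].
Qed.

Lemma C5_labelling : labelling 5 C5_edges (fun x : cycle_graph 5 => x : nat).
Proof.
split; [exact: val_inj | exact: ltn_ord | exact: card_ord |].
by move=> [[|[|[|[|[|i]]]]] ?] [[|[|[|[|[|j]]]]] ?].
Qed.

Lemma C9_labelling : labelling 9 C9_edges (fun x : cycle_graph 9 => x : nat).
Proof.
split; [exact: val_inj | exact: ltn_ord | exact: card_ord |].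
by move=> [[|[|[|[|[|[|[|[|[|i]]]]]]]]] ?] [[|[|[|[|[|[|[|[|[|j]]]]]]]]] ?].
Qed.

Definition D7_label (x : D7) : nat :=
  match x with
  | Some (inl i) => i
  | Some (inr i) => 3 + i
  | None => 6
  end.

Lemma D7_labelling : labelling 7 D7_edges D7_label.
Proof.
split.
- move=> [[[[|[|[|i]]] p]|[[|[|[|i]]] p]]|] [[[[|[|[|j]]] q]|[[|[|[|j]]] q]]|] //= _;
  by rewrite (bool_irrelevance p q).
- by move=> [[[[|[|[|i]]] ?]|[[|[|[|i]]] ?]]|].
- by rewrite card_option card_sum !card_ord.
(* Replaces equality of sets in [subdivide_rel] by vertex comparisons, which compute in the case
   analysis. *)
have pair_eq (T : finType) (x y u v : T) :
    ([set x; y] == [set u; v]) = ((x == u) && (y == v)) || ((x == v) && (y == u)).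
  apply/eqP/idP => [eqs | /orP[]/andP[/eqP-> /eqP->] //]; last exact: setUC.
  have: x \in [set u; v] by rewrite -eqs set21.
  have: y \in [set u; v] by rewrite -eqs set22.
  have: u \in [set x; y] by rewrite eqs set21.
  have: v \in [set x; y] by rewrite eqs set22.
  rewrite !inE ![_ == x]eq_sym ![_ == y]eq_sym.
  by case: (x == u); case: (x == v); case: (y == u); case: (y == v).
move=> [x|] [y|]; rewrite /= /edge_rel /= ?pair_eq ?inE //=.
- by case: x y => [[[|[|[|i]]] ?]|[[|[|[|i]]] ?]] [[[|[|[|j]]] ?]|[[|[|[|j]]] ?]].
- by case: x => [[[|[|[|i]]] ?]|[[|[|[|i]]] ?]].
by case: y => [[[|[|[|i]]] ?]|[[|[|[|i]]] ?]].
Qed.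

Definition Petersen_label (x : petersen_minus_vertex) : nat :=
  let: (b, i) := val x in if b then 4 + i else i.-1.

Lemma Petersen_labelling : labelling 9 Petersen_edges Petersen_label.
Proof.
split.
- move=> [[b i] nx] [[c j] ny]; rewrite /Petersen_label /= => eqbc.
  apply: val_inj => /=; move: b c i j eqbc nx ny.
  by move=> [] [] [[|[|[|[|[|i]]]]] p] [[|[|[|[|[|j]]]]] q] //= _;
    rewrite (bool_irrelevance p q).
- by move=> [[[] [[|[|[|[|[|i]]]]] ?]] nx].
- by rewrite card_sig cardC1 card_prod card_bool card_ord.
move=> [[b i] nx] [[c j] ny]; rewrite /Petersen_label /=.
by move: b c i j nx ny =>
  [] [] [[|[|[|[|[|i]]]]] p] [[|[|[|[|[|j]]]]] q].
Qed.

(** * From copies found by the search to embeddings *)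

Lemma copy_embedding (F G : sgraph) m n E' (l : F -> nat) E T (f : nat -> G) W :
  labelling m E' l -> realizes n E T f ->
  copy n (nth [::] (table n E)) E' W -> size W = m ->
  sub_embedding (fun x => f (nth 0 W (l x))).
Proof.
move=> lE' fE /and3P[uW /all_nthP ltW /allP copyW] sW.
have ltn x : nth 0 W (l x) < n by apply: ltW; rewrite sW (label_lt lE').
split=> [x y /(realizes_inj fE)|x y].
  move=> /(_ (ltn x) (ltn y))/eqP; rewrite nth_uniq ?sW ?(label_lt lE') //.
  by move=> /eqP/(label_inj lE').
rewrite (label_edge lE') => /orP[] /copyW /(realizes_nbr fE)[_ _] //=.
by rewrite edge_sym.
Qed.

Lemma search_embedding (F G : sgraph) m n E' (l : F -> nat) E T (f : nat -> G) :
  labelling m E' l -> realizes n E T f ->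
  search n (nth [::] (table n E)) E' (back m E') [::] ->
  exists h : F -> G, sub_embedding h.
Proof.
move=> lE' fE /search_copy[W copyW]; rewrite size_mkseq => sW.
by exists (fun x => f (nth 0 W (l x))); apply: copy_embedding lE' fE copyW sW.
Qed.

(** * Soundness of the exploration *)

Section Exploration.
Variable H : sgraph.
Hypotheses (H_connected : connected H) (H_triangle_free : triangle_free H)
  (H_subcubic : subcubic H) (R1 : forall x : H, deg x <> 1)
  (R2 : forall x y : H, x -- y -> ~ (deg x = 2 /\ deg y = 2))
  (R3 : forall w1 w2 w3 w4 : H,
      induced_C4 w1 w2 w3 w4 -> ~ (deg w1 = 2 /\ deg w3 = 2))
  (R4 : forall x y : H, ~ cut_edge x y)
  (H_S333_free : ~ has_subgraph (spider 3 3 3) H).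

Lemma realizes_not_refuted n E T (f : nat -> H) : realizes n E T f ->
  ~~ refuted n (nth [::] (table n E)) E T.
Proof.
move=> fE; rewrite /refuted; case: ifP => [/hasP[[i j] Eij /andP[/= Ti Tj]]|_].
  have [_ _ /R2[]] := realizes_edge fE Eij.
  by split; [have [] := realizes_deg fE Ti | have [] := realizes_deg fE Tj].
case: ifP => [/hasP[i Ti /hasP[j Tj /andP[nij]]]|_].
  set s := filter _ _; have us : uniq s by rewrite filter_uniq // uniq_table.
  case def_s: s => [|a [|b s']] // _; move: us.
  rewrite def_s /= inE negb_or -andbA => /andP[nab _].
  have: a \in s by rewrite def_s mem_head.
  have: b \in s by rewrite def_s !inE eqxx orbT.
  rewrite !mem_filter.
  move=> /andP[/(realizes_nbr fE)[_ ltbn jb] /(realizes_nbr fE)[_ _ ib]].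
  move=> /andP[/(realizes_nbr fE)[ltjn ltan ja] /(realizes_nbr fE)[ltin _ ia]].
  have neq c d : c < n -> d < n -> c != d -> f c != f d.
    by move=> cn dn; apply: contraNneq => /(realizes_inj fE) ->.
  have [_ di] := realizes_deg fE Ti; have [_ dj] := realizes_deg fE Tj.
  (* The common neighbours [a] and [b] close a 4-cycle through [i] and [j]; either diagonal would
     create a triangle. *)
  case: (@R3 (f i) (f a) (f j) (f b)) => //; split.
  - have nadj c d : f c -- f d -> f c != f d.
      by apply: contraTneq => ->; rewrite edge_irrefl.
    rewrite /= !inE !negb_or [f a == f j]eq_sym.
    by rewrite (nadj i a) ?(nadj i b) ?(nadj j a) ?(nadj j b) ?neq.
  - by rewrite [f a -- _]edge_sym [f b -- _]edge_sym.
  - by apply/negP => ij; apply: (H_triangle_free (And3 ij ja _)); rewrite edge_sym.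
  by apply/negP => ab; apply: (H_triangle_free (And3 ia ab _)); rewrite edge_sym.
case: ifP => [|_].
  rewrite /has_spider someE => /hasP[c _]; case: ifP => // /eqP sNc.
  case/search_copy => W copyW sW; case: H_S333_free.
  exists (fun x => f (nth 0 W (spider_label x))).
  by apply: copy_embedding spider_labelling fE copyW _; rewrite sW /= sNc.
rewrite someE; apply/hasPn => i _; rewrite someE; apply/hasPn => j ij.
by apply/negP => /(cut_sideP fE H_subcubic H_connected ij) /R4.
Qed.

Definition conclusion :=
  [\/ isomorphic H D7, isomorphic H petersen_minus_vertex,
      overfull H /\ cycle_with_chords 9 4 H | edge_colorable H 3].

Section Closed.
Variables (n : nat) (E : seq (nat * nat)) (T : seq nat) (f : nat -> H).
Hypotheses (fE : realizes n E T f) (n_gt0 : 0 < n).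
Let N := nth [::] (table n E).
Hypothesis all_full : forall i, i < n -> full N T i.

(** All vertices being full, the image of [f] is closed under adjacency; it contains [f 0], and [H]
    is connected. *)
Lemma closed_onto x : exists2 i, i < n & x = f i.
Proof.
have fA : closed (@edge_rel H) (mem (mkseq f n)).
  apply: (intro_closed (sym_connect_sym (@edge_sym H))) => y z yz /mapP[i].
  rewrite mem_iota => /= ltin def_y; rewrite def_y in yz.
  have [j /(realizes_nbr fE)[_ ltjn _] ->] :=
    full_nbr fE H_subcubic (all_full ltin) yz.
  by apply: map_f; rewrite mem_iota.
have: f 0 \in mkseq f n by apply: map_f; rewrite mem_iota.
rewrite (closed_connect fA (H_connected (f 0) x)) => /mapP[i].
by rewrite mem_iota => /= ltin ->; exists i.
Qed.

(** The label inverts [f]. Fullness makes [E] complete: any edge of [H] leads to a listed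
    neighbour. *)
Lemma closed_labelling : labelling n E (fun x => index x (mkseq f n)).
Proof.
have uf : uniq (mkseq f n).
  by apply/mkseq_uniqP => i j; rewrite !inE => ? ?; apply: (realizes_inj fE).
have mem_f x : x \in mkseq f n.
  by have [i ltin ->] := closed_onto x; apply: map_f; rewrite mem_iota.
have indexf i : i < n -> index (f i) (mkseq f n) = i.
  by move=> ltin; rewrite -(nth_mkseq (f 0) f ltin) index_uniq ?size_mkseq.
split=> [x y eqxy|x||x y].
- by rewrite -(nth_index (f 0) (mem_f x)) eqxy nth_index.
- by rewrite -[ltnRHS](size_mkseq f) index_mem.
- rewrite -[RHS](size_mkseq f) -(card_uniqP uf).
  by apply: eq_card => x; rewrite mem_f.
have [[i ltin ->] [j ltjn ->]] := (closed_onto x, closed_onto y).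
rewrite !indexf //; apply/idP/idP => [ij|Eij].
  have [k ik /(realizes_inj fE) eqjk] := full_nbr fE H_subcubic (all_full ltin) ij.
  have [_ ltkn _] := realizes_nbr fE ik.
  by move: ik; rewrite -(eqjk ltjn ltkn) mem_table => /andP[].
suff /(realizes_nbr fE)[] : j \in N i by [].
by rewrite mem_table ltin.
Qed.

Hypothesis E_simple : uniq E && all (fun e => e.1 < e.2) E.

Lemma closed_card : #|H| = n. Proof. exact: label_card closed_labelling. Qed.

Lemma closed_card_edges : #|edges H| = size E.
Proof.
have [uE /allP ltE] := andP E_simple.
apply: (card_edges closed_labelling uE); apply/allP => -[i j] Eij /=.
by rewrite (ltE (i, j)) //; have [] := realizes_edge fE Eij.
Qed.

Lemma closed_isomorphic (F : sgraph) m E' (l : F -> nat) : labelling m E' l ->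
  uniq E' && all (fun e => e.1 < e.2 < m) E' -> spanned n N E m E' -> isomorphic H F.
Proof.
move=> lE' /andP[uE' ltE']; rewrite /spanned; case: ifP => // /andP[/eqP nm /eqP sE].
case/(search_embedding lE' fE) => h h_sub; apply: sub_embedding_isomorphic h_sub _ _.
  by rewrite (label_card lE') closed_card.
by rewrite (card_edges lE' uE' ltE') closed_card_edges.
Qed.

End Closed.

Lemma closed_outcome n E T (f : nat -> H) : realizes n E T f -> 0 < n ->
  (forall i, i < n -> full (nth [::] (table n E)) T i) ->
  outcome n (nth [::] (table n E)) E -> conclusion.
Proof.
move=> fE n_gt0 fullE; have lE := closed_labelling fE n_gt0 fullE.
rewrite /outcome; case: ifP => [colE _|_].
  by apply: Or44; apply: labelling_edge_colorable lE colE.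
case: ifP => // /negbFE E_simple.
case: ifP => [sp _|_].
  apply: Or41.
  exact: (closed_isomorphic fE n_gt0 fullE E_simple D7_labelling _ sp).
case: ifP => [sp _|_].
  apply: Or42.
  exact: (closed_isomorphic fE n_gt0 fullE E_simple Petersen_labelling _ sp).
case: ifP => // /andP[/eqP n9 /eqP sE] /(search_embedding C9_labelling fE)[h h_sub].
have cardH : #|H| = 9 by rewrite -n9; apply: closed_card fE n_gt0 fullE.
have edgesH : #|edges H| = 13.
  by rewrite -sE; apply: closed_card_edges fE n_gt0 fullE E_simple.
(* Here $9 = 2 \cdot 4 + 1$ and $4 \cdot 3 < 13$. *)
apply: Or43; split; first by apply: (@overfull_odd H 4); rewrite ?cardH ?edgesH.
split=> //; exists h; split=> //.
(* The chords number $13 - 9 = 4$. *)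
rewrite cardsD (setIidPr (sub_embedding_edges h_sub)).
by rewrite (card_sub_embedding_edges h_sub) (card_edges C9_labelling) // edgesH.
Qed.

(** Induction on the fuel: the actual situation at [f v] in [H] selects a branch whose
    reconstruction is again realized. *)
Lemma exploreP k n E T (f : nat -> H) : realizes n E T f -> 0 < n ->
  explore k n E T -> conclusion.
Proof.
elim: k n E T f => // k IH n E T f fE n_gt0 /=.
rewrite (negPf (realizes_not_refuted fE)).
set N := nth [::] (table n E).
case def_o: [seq i <- iota 0 n | ~~ full N T i] => [|v o].
  apply: (closed_outcome fE n_gt0) => i ltin; apply: contraT => nfull.
  have: i \in [seq i <- iota 0 n | ~~ full N T i].
    by rewrite mem_filter nfull mem_iota.
  by rewrite def_o.
have: v \in [seq i <- iota 0 n | ~~ full N T i] by rewrite def_o mem_head.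
rewrite mem_filter mem_iota => /= /andP[v_open ltvn].
case/and3P => okdeg /allP okold oknew.
(* Either all neighbours of [f v] are known, or there is a further one, [y]. *)
have [led | gtd] := leqP (deg (f v)) (size (N v)).
  have eqd : deg (f v) = size (N v).
    apply/eqP; rewrite eqn_leq led -(card_realizes_nbrs fE).
    exact/subset_leq_card/(realizes_nbrs_sub fE).
  move: okdeg; rewrite -eqd; case: ifP => [/eqP/R1//|_]; case: ifP => // /eqP d2.
  apply: IH n_gt0; split; [exact: realizes_inj fE | exact: realizes_edge fE |].
  by move=> i; rewrite inE => /predU1P[->//|/(realizes_deg fE)].
have [y vy y_new] : exists2 y, f v -- y & y \notin map f (N v).
  have: ~~ ([set y | f v -- y] \subset [set:: map f (N v)]).
    by apply/negP => /subset_leq_card; rewrite (card_realizes_nbrs fE) leqNgt gtd.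
  by case/subsetPn => y; rewrite !inE => vy y_new; exists y.
have [/mapP[u] | y_fresh] := boolP (y \in mkseq f n).
  rewrite mem_iota => /= ltun def_y; move: vy y_new; rewrite {}def_y => vu u_new.
  have Nvu : u \notin N v by apply: contra u_new; apply: map_f.
  move: (okold u); rewrite mem_iota ltun => /(_ isT); case: ifP => [|_]; last first.
    apply: IH n_gt0; split; [exact: realizes_inj fE | | exact: realizes_deg fE].
    by move=> i j; rewrite inE => /predU1P[[-> ->]//|/(realizes_edge fE)].
  case/or4P => [/eqP eq_uv | fullu | Nu | /hasP[w vw uw]].
  - by rewrite eq_uv edge_irrefl in vu.
  (* If [u] is full, then [f v] is one of its known neighbours, so [u] is already listed at [v]. *)
  - rewrite edge_sym in vu; have [j uj] := full_nbr fE H_subcubic fullu vu.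
    have [_ ltjn _] := realizes_nbr fE uj.
    move=> /(realizes_inj fE ltvn ltjn) eq_vj.
    by rewrite (table_sym fE) eq_vj uj in Nvu.
  - by rewrite Nu in Nvu.
  have [_ _ fvw] := realizes_nbr fE vw; have [_ _ fuw] := realizes_nbr fE uw.
  by case: (@H_triangle_free (f v) (f u) (f w)); rewrite vu fuw edge_sym fvw.
(* A neighbour outside the image of [f] becomes the vertex [n]. *)
pose f' i := if i == n then y else f i.
have f'E i : i < n -> f' i = f i by rewrite /f' => ltin; rewrite ltn_eqF.
have f'n : f' n = y by rewrite /f' eqxx.
have f_neq i : i < n -> f i <> y.
  by move=> ltin eqy; rewrite -eqy map_f // mem_iota in y_fresh.
apply: (IH _ _ _ f' _ _ oknew) => //; split=> [i j|i j|i].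
- rewrite ltnS leq_eqVlt => /predU1P[->|ltin];
    rewrite ltnS leq_eqVlt => /predU1P[->|ltjn] //.
  + by rewrite f'n (f'E j) // => /esym/f_neq; case.
  + by rewrite f'n f'E // => /f_neq; case.
  by rewrite !f'E //; apply: (realizes_inj fE).
- rewrite inE => /predU1P[[-> ->]|/(realizes_edge fE)[ltin ltjn ij]].
    by rewrite f'n f'E // ltnS leqnn ltnW.
  by rewrite (f'E i) // (f'E j) // !ltnS (ltnW ltin) (ltnW ltjn).
by move=> /(realizes_deg fE)[ltin]; rewrite f'E // ltnS ltnW.
Qed.

End Exploration.

(** * Running the exploration from the 5-cycle *)

(** The fuel 40 bounds the depth of the search tree; exhausted fuel returns [false], so the
    computation also certifies that it suffices. *)
Lemma explore_C5 : explore 40 5 C5_edges [::].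
Proof. by vm_compute. Qed.

Theorem theorem7 (H : sgraph)
  (H_connected : connected H)
  (H_triangle_free : triangle_free H)
  (H_subcubic : subcubic H)
  (R1 : forall x : H, deg x <> 1)
  (R2 : forall x y : H, x -- y -> ~ (deg x = 2 /\ deg y = 2))
  (R3 : forall w1 w2 w3 w4 : H,
      induced_C4 w1 w2 w3 w4 -> ~ (deg w1 = 2 /\ deg w3 = 2))
  (R4 : forall x y : H, ~ cut_edge x y)
  (H_S333_free : ~ has_subgraph (spider 3 3 3) H)
  (H_C5 : has_induced_subgraph (cycle_graph 5) H) :
  [\/ isomorphic H D7,
      isomorphic H petersen_minus_vertex,
      overfull H /\ cycle_with_chords 9 4 H
    | edge_colorable H 3].
Proof.
have [h [h_inj h_edge]] := H_C5.
(* From 5 on, [inord] returns a default; [realizes] constrains only the indices below 5. *)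
pose f i := h (inord i : cycle_graph 5).
have fE : realizes 5 C5_edges [::] f.
  split=> // [i j lti ltj /h_inj/(congr1 val)/=|i j]; first by rewrite !inordK.
  rewrite !inE => /or4P[|||/orP[]] /eqP[-> ->];
    by rewrite /f h_edge (label_edge C5_labelling) !inordK.
exact: (exploreP H_connected H_triangle_free H_subcubic R1 R2 R3 R4 H_S333_free
          fE isT explore_C5).
Qed.
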